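(* Let $M$ be a real $2\times 2$ matrix with real eigenvalues $\sigma_1\ge\sigma_2>0$ and let $\{\mathbf{v}_1,\mathbf{v}_2\}$ be a basis of $\mathbb{R}^2$ consisting of unit eigenvectors of $M$, $M\mathbf{v}_k=\sigma_k\mathbf{v}_k$, $\Vert\mathbf{v}_k\Vert=1$, $k=1,2$. If $$\sigma_1+\sigma_2-2\ge 0$$ and the vector $\mathbf{w}=\mu_1\mathbf{v}_1+\mu_2\mathbf{v}_2\neq\mathbf{0}$ ($\mu_1,\mu_2\in\mathbb{R}$) is chosen so that $$|\mu_1|\ge|\mu_2|>0,$$ then, for every integer $n\ge 2$, the Bézier curve of degree $n$ generated by $M$ and $\mathbf{w}$ has monotonic curvature $\kappa$ on $[0,1]$ (decreasing if $\kappa(0)>0$ and increasing if $\kappa(0)<0$).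
   Context: Given a real $2\times2$ matrix $M$ and $\mathbf{w}\in\mathbb{R}^2\setminus\{\mathbf{0}\}$, the Bézier curve of degree $n$ generated by $M$ and $\mathbf{w}$ is $c(t)=\sum_{j=0}^n b_jB_j^n(t)$, $t\in[0,1]$, where $B_j^n(t)=\binom{n}{j}t^j(1-t)^{n-j}$ are the Bernstein polynomials and the control points $b_j\in\mathbb{R}^2$ satisfy $b_{j+1}-b_j=M^j\mathbf{w}$ for $j=0,\dots,n-1$ ($b_0$ is arbitrary). The (signed) curvature is $\kappa(t)=\det(c'(t),c''(t))/\Vert c'(t)\Vert^3$, with $\Vert\cdot\Vert$ the Euclidean norm. *)

(* Defs.v *)
From HB Require Import structures.
From mathcomp Require Import all_boot all_order all_algebra.
From mathcomp Require Import all_classical all_reals all_analysis.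

Set Implicit Arguments.
Unset Strict Implicit.
Unset Printing Implicit Defensive.

Import Order.TTheory GRing.Theory Num.Theory.
Import numFieldNormedType.Exports.

Local Open Scope ring_scope.

Section PlaneCurves.
Variable R : realType.

(* The library norm `|v| on matrices is the sup norm, hence this definition. *)
Definition enorm (v : 'cV[R]_2) : R := Num.sqrt (\sum_i v i 0 ^+ 2).

Definition det2 (u v : 'cV[R]_2) : R := \det (row_mx u v : 'M[R]_2).

(* Derivatives are taken on the whole line; for the Bezier curves below, which
   are polynomial in t, at t = 0 and t = 1 they agree with the one-sided ones. *)
Definition curvature (c : R -> 'cV[R]_2) (t : R) : R :=
  det2 (derive1 c t) (derive1n 2 c t) / enorm (derive1 c t) ^+ 3.

Definition bernstein (n j : nat) (t : R) : R :=
  'C(n, j)%:R * t ^+ j * (1 - t) ^+ (n - j).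

(* Only b 0, ..., b n matter. *)
Definition bezier (n : nat) (b : nat -> 'cV[R]_2) (t : R) : 'cV[R]_2 :=
  \sum_(j < n.+1) bernstein n j t *: b j.

Definition generated_by (M : 'M[R]_2) (w : 'cV[R]_2) (n : nat)
    (b : nat -> 'cV[R]_2) : Prop :=
  forall j : nat, (j < n)%N -> b j.+1 - b j = M ^+ j *m w.

End PlaneCurves.

Definition nondecreasing_on01 (R : realType) (f : R -> R) : Prop :=
  {in `[0, 1] &, {homo f : x y / x <= y}}.

Definition nonincreasing_on01 (R : realType) (f : R -> R) : Prop :=
  {in `[0, 1] &, {homo f : x y /~ x <= y}}.

Definition increasing_on01 (R : realType) (f : R -> R) : Prop :=
  {in `[0, 1] &, {homo f : x y / x < y}}.

Definition decreasing_on01 (R : realType) (f : R -> R) : Prop :=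
  {in `[0, 1] &, {homo f : x y /~ x < y}}.

Definition monotonic_on01 (R : realType) (f : R -> R) : Prop :=
  nondecreasing_on01 f \/ nonincreasing_on01 f.

(* Main.v *)
Require Import Defs.
From HB Require Import structures.
From mathcomp Require Import all_boot all_order all_algebra.
From mathcomp Require Import all_classical all_reals all_analysis.
From mathcomp Require Import ring lra.

(** The derivative of a Bezier curve is a Bezier curve whose control points are
    the scaled differences of the original ones ([hodograph]).  For a generated
    curve these differences are M^j w, so in the eigenbasis they are geometric
    sequences, and the binomial formula sums them ([bezier_geometric]):
      c'(t) = n (mu1 A^m v1 + mu2 B^m v2),   m = n - 1,
      A = 1 - t + t sigma1,   B = 1 - t + t sigma2.
    Differentiating once more and taking determinants, A (sigma2 - 1) -
    B (sigma1 - 1) collapses to the constant sigma2 - sigma1, whence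
    ([curvature_generated])
      kappa(t) = C (A B)^(m-1) / N(t)^(3/2),   N = x^2 + 2 c x y + y^2,
      x = |mu1| A^m,   y = |mu2| B^m,
    where C is a constant and c is, up to sign, the cosine of the angle between
    v1 and v2; independence of v1 and v2 gives |c| < 1 through the Lagrange
    identity.  Only the positive factor after C depends on t, so it remains to
    see that it decreases strictly when sigma2 < sigma1, C being zero otherwise.
    This is [profile_lt], which compares two parameter values directly, without
    differentiating, by means of two facts.

    - N increases strictly ([qform_lt]).  Indeed
        2 N = (1 - c) (x - y)^2 + (1 + c) (x + y)^2,
      and x - y >= 0 increases strictly while x + y does not decrease.  Here the
      hypothesis sigma1 + sigma2 >= 2 enters: together with sigma2 < sigma1 it
      says that A grows faster than B, and at least as fast as B may shrink;
      as B <= A and |mu2| <= |mu1|, this passes to x and y ([ltr_subXX]).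

    - N / (x y) = x / y + y / x + 2 c does not decrease ([qform_div_le]), since
      x / y >= 1 does not decrease.  As x y is a multiple of (A B)^m, the
      quotient (A B)^m / N does not increase.

    The second fact also gives that (A B)^(m-1) / N does not increase: where A B
    grows, (A B)^(m-1) grows by a smaller factor than (A B)^m, and where it does
    not grow, N alone decides.  Dividing by the strictly increasing square root
    of N gives the claim. *)

Import Order.TTheory GRing.Theory Num.Theory.
Import numFieldNormedType.Exports.

Set Implicit Arguments.
Unset Strict Implicit.

Local Open Scope ring_scope.

(** * Monotonicity of the curvature profile *)

(** Factoring the differences of powers as (a' - a) Sa and (b' - b) Sb, the
    cofactors satisfy 0 < Sb <= Sa because the b's lie below the a's, so the
    comparison of increments survives raising to a power.  The two bounds
    cannot be merged into one on the absolute value: only the first is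
    strict. *)
Lemma ltr_subXX (R : realFieldType) (m : nat) (a b a' b' : R) :
  0 < b <= a -> 0 < b' <= a' -> b' - b < a' - a -> b - b' <= a' - a ->
  b' ^+ m.+1 - b ^+ m.+1 < a' ^+ m.+1 - a ^+ m.+1
  /\ b ^+ m.+1 - b' ^+ m.+1 <= a' ^+ m.+1 - a ^+ m.+1.
Proof.
move=> /andP[b0 ba] /andP[b'0 ba'] h1 h2.
rewrite -(opprB (b' ^+ _)) !subrXX.
set Sb := \sum_(i < _) _; set Sa := \sum_(i < _) _.
have [a0 a'0] := (lt_le_trans b0 ba, lt_le_trans b'0 ba').
have Sb0 : 0 < Sb.
  rewrite /Sb big_ord_recl ltr_wpDr ?mulr_gt0 ?exprn_gt0// sumr_ge0// => i _.
  by rewrite mulr_ge0 ?exprn_ge0 // ltW.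
have Sba : Sb <= Sa.
  apply: ler_sum => i _.
  by apply: ler_pM; rewrite ?exprn_ge0 ?lerXn2r ?nnegrE // ltW.
split; nra.
Qed.

(** The squared length of x u + y v for unit vectors u, v at an angle of
    cosine c. *)
Definition qform (R : realFieldType) (c x y : R) : R :=
  x ^+ 2 + 2 * c * x * y + y ^+ 2.

Lemma qform_gt0 (R : realFieldType) (c x y : R) :
  -1 < c < 1 -> 0 < x -> 0 < y -> 0 < qform c x y.
Proof.
move=> /andP[c1 c2] x0 y0; rewrite /qform.
have : 0 < (1 + c) * (x * y) by rewrite !mulr_gt0//; lra.
have := sqr_ge0 (x - y); nra.
Qed.

(** In the coordinates x - y and x + y the form is diagonal with positive
    coefficients (1 - c) / 2 and (1 + c) / 2, so it grows when one coordinate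
    does and the other does not shrink. *)
Lemma qform_lt (R : realFieldType) (c x y x' y' : R) :
  -1 < c < 1 -> 0 < y <= x -> y' - y < x' - x -> y - y' <= x' - x ->
  qform c x y < qform c x' y'.
Proof.
move=> /andP[c1 c2] /andP[y0 yx] h1 h2; rewrite /qform.
have dlt : (1 - c) * (x - y) ^+ 2 < (1 - c) * (x' - y') ^+ 2.
  by rewrite ltr_pM2l ?ltr_pXn2r ?nnegrE //; lra.
have sle : (1 + c) * (x + y) ^+ 2 <= (1 + c) * (x' + y') ^+ 2.
  by rewrite ler_pM2l ?lerXn2r ?nnegrE //; lra.
lra.
Qed.

(** The quotient of the form by x y depends only on r = x / y, as r + 1 / r + 2 c,
    which does not decrease with r on r >= 1; the statement is cleared of
    denominators. *)
Lemma qform_div_le (R : realFieldType) (c x y x' y' : R) :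
  0 < y <= x -> 0 < y' <= x' -> x * y' <= x' * y ->
  x' * y' * qform c x y <= x * y * qform c x' y'.
Proof.
move=> /andP[y0 yx] /andP[y'0 yx'] h.
rewrite -subr_ge0.
have -> : x * y * qform c x' y' - x' * y' * qform c x y
    = (x' * y - x * y') * (x * x' - y * y') by rewrite /qform; ring.
by rewrite mulr_ge0 // ?subr_ge0 // ler_pM // ltW.
Qed.

(** The curvature of a generated curve of degree k + 2, up to a constant factor,
    in terms of the two eigenvalue interpolants a and b. *)
Definition profile (R : realType) (c al be : R) (k : nat) (a b : R) : R :=
  (a * b) ^+ k / Num.sqrt (qform c (al * a ^+ k.+1) (be * b ^+ k.+1)) ^+ 3.

Lemma profile_gt0 (R : realType) (c al be : R) (k : nat) (a b : R) :
  -1 < c < 1 -> 0 < al -> 0 < be -> 0 < a -> 0 < b ->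
  0 < profile c al be k a b.
Proof.
move=> hc al0 be0 a0 b0.
rewrite divr_gt0 ?exprn_gt0 ?mulr_gt0 ?sqrtr_gt0 //.
by rewrite qform_gt0 // mulr_gt0 ?exprn_gt0.
Qed.

(** The quotient splits as ((a b)^k / N) * (1 / sqrt N), N being the form: the
    first factor does not increase and the second decreases strictly. *)
Lemma profile_lt (R : realType) (c al be : R) (k : nat) (a b a' b' : R) :
  -1 < c < 1 -> 0 < be <= al ->
  0 < b <= a -> 0 < b' <= a' -> b' - b < a' - a -> b - b' <= a' - a ->
  a * b' <= a' * b ->
  profile c al be k a' b' < profile c al be k a b.
Proof.
move=> hc /andP[be0 beal] hb hb' h1 h2 h3.
have [/andP[b0 ba] /andP[b'0 ba']] := (hb, hb').
have a0 := lt_le_trans b0 ba; have a'0 := lt_le_trans b'0 ba'.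
have al0 := lt_le_trans be0 beal.
have [p1 p2] := ltr_subXX k hb hb' h1 h2.
have ax : 0 < a ^+ k.+1 by rewrite exprn_gt0.
have ax' : 0 < a' ^+ k.+1 by rewrite exprn_gt0.
have bx : 0 < b ^+ k.+1 by rewrite exprn_gt0.
have bx' : 0 < b' ^+ k.+1 by rewrite exprn_gt0.
have le_bax : b ^+ k.+1 <= a ^+ k.+1 by rewrite lerXn2r ?nnegrE // ltW.
have le_bax' : b' ^+ k.+1 <= a' ^+ k.+1 by rewrite lerXn2r ?nnegrE // ltW.
have h3x : a ^+ k.+1 * b' ^+ k.+1 <= a' ^+ k.+1 * b ^+ k.+1.
  by rewrite -!exprMn lerXn2r ?nnegrE ?mulr_ge0 // ltW.
rewrite /profile.
set x := al * a ^+ _; set y := be * b ^+ _.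
set x' := al * a' ^+ _; set y' := be * b' ^+ _.
have hxy : 0 < y <= x by rewrite /x /y mulr_gt0 //= ler_pM // ltW.
have hxy' : 0 < y' <= x' by rewrite /x' /y' mulr_gt0 //= ler_pM // ltW.
have [/andP[y0 yx] /andP[y'0 yx']] := (hxy, hxy').
have Nlt : qform c x y < qform c x' y'.
  apply: qform_lt => //; rewrite /x /y /x' /y'; nra.
have N0 : 0 < qform c x y by apply: qform_gt0 => //; apply: lt_le_trans yx.
have N'0 := lt_trans N0 Nlt.
have Kle : x' * y' * qform c x y <= x * y * qform c x' y'.
  apply: qform_div_le => //.
  have := ler_wpM2l (ltW (mulr_gt0 al0 be0)) h3x.
  by rewrite /x /y /x' /y'; congr (_ <= _); ring.
move: (qform c x y) (qform c x' y') N0 N'0 Nlt Kle => N N' N0 N'0 Nlt Kle.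
set d := a * b; set d' := a' * b'.
have d0 : 0 < d by rewrite mulr_gt0.
have d'0 : 0 < d' by rewrite mulr_gt0.
have {}Kle : d' ^+ k.+1 * N <= d ^+ k.+1 * N'.
  rewrite -(ler_pM2l (mulr_gt0 al0 be0)) /d /d' !exprMn.
  by move: Kle; rewrite /x /y /x' /y'; congr (_ <= _); ring.
(* Lowering the exponent is harmless: if d grows, d ^+ k grows by a smaller
   factor than d ^+ k.+1; if it does not, N < N' suffices. *)
have dle : d' ^+ k * N <= d ^+ k * N'.
  case: (leP d' d) => dd.
    by rewrite ler_pM ?exprn_ge0 ?lerXn2r ?nnegrE // ltW.
  rewrite -(ler_pM2l d'0) (le_trans (y := d ^+ k.+1 * N')) //.
    by rewrite mulrA -exprS.
  rewrite exprS -mulrA ler_pM // ?mulr_ge0 ?exprn_ge0 //; exact: ltW.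
have s0 : 0 < Num.sqrt N by rewrite sqrtr_gt0.
have s'0 : 0 < Num.sqrt N' by rewrite sqrtr_gt0.
have slt : Num.sqrt N < Num.sqrt N' by rewrite ltr_sqrt.
have cubeE (M : R) : 0 < M -> Num.sqrt M ^+ 3 = M * Num.sqrt M.
  by move=> M0; rewrite exprSr sqr_sqrtr // ltW.
rewrite !cubeE // ltr_pdivrMr ?mulr_gt0 // mulrAC ltr_pdivlMr ?mulr_gt0 //.
apply: (@le_lt_trans _ _ (d ^+ k * N' * Num.sqrt N)).
  by rewrite mulrA ler_pM2r.
by rewrite mulrA ltr_pM2l // mulr_gt0 // exprn_gt0.
Qed.

(** * Derivatives of Bezier curves *)

Lemma derive1_horner_comb (R : realType) (k : nat) (p : 'I_k -> {poly R})
    (b : 'I_k -> 'cV[R]_2) (t : R) :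
  derive1 (fun s => \sum_j (p j).[s] *: b j) t = \sum_j (p j)^`().[t] *: b j.
Proof.
have entryE i l : (fun s => (\sum_j (p j).[s] *: b j) i l)
    = horner (\sum_j b j i l *: p j).
  apply/funext => s; rewrite horner_sum summxE.
  by apply: eq_bigr => j _; rewrite mxE hornerZ mulrC.
rewrite derive1E derive_mx; last first.
  by apply/derivable_mxP => i l; rewrite entryE; exact: derivable_horner.
apply/matrixP => i l; rewrite mxE entryE derive_val (linear_sum (@deriv R)).
rewrite horner_sum summxE.
by apply: eq_bigr => j _; rewrite /= derivZ hornerZ mxE mulrC.
Qed.

Definition bernstein_poly {R : realType} (n j : nat) : {poly R} :=
  'C(n, j)%:R *: ('X^j * (1 - 'X) ^+ (n - j)).

Lemma horner_bernstein_poly (R : realType) (n j : nat) (t : R) :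
  (bernstein_poly n j).[t] = bernstein n j t.
Proof.
by rewrite /bernstein_poly /bernstein hornerZ hornerM hornerXn horner_exp !hornerE ?mulrA.
Qed.

Lemma deriv_bernstein_poly0 (R : realType) (n : nat) :
  (bernstein_poly n.+1 0)^`() = - (n.+1%:R *: bernstein_poly n 0) :> {poly R}.
Proof.
rewrite /bernstein_poly !bin0 !scale1r !expr0 !mul1r !subn0 deriv_exp.
by rewrite derivB derivX -polyC1 derivC sub0r mulN1r mulNrn scaler_nat.
Qed.

Lemma deriv_bernstein_polyS (R : realType) (n j : nat) :
  (bernstein_poly n.+1 j.+1)^`()
  = n.+1%:R *: (bernstein_poly n j - bernstein_poly n j.+1) :> {poly R}.
Proof.
have e1 : j.+1%:R * 'C(n.+1, j.+1)%:R = n.+1%:R * 'C(n, j)%:R :> R.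
  by rewrite -!natrM -mul_bin_diag.
have e2 : (n - j)%:R * 'C(n.+1, j.+1)%:R = n.+1%:R * 'C(n, j.+1)%:R :> R.
  by rewrite -!natrM -[(n - j)%N]subSS -mul_bin_down.
rewrite /bernstein_poly subSS derivZ derivM derivXn deriv_exp /=.
rewrite derivB derivX -polyC1 derivC sub0r mulN1r mulNrn mulrN -subnS.
rewrite mulrnAl mulrnAr !scalerBr !scalerA -e1 -e2.
have scaleMn (c : R) (p : {poly R}) i : c *: (p *+ i) = (i%:R * c) *: p.
  by rewrite -scaler_nat scalerA mulrC.
by rewrite !scaleMn.
Qed.

(** Summation by parts: each Bernstein polynomial has a difference of two
    Bernstein polynomials of lower degree as derivative, and the difference is
    moved onto the control points. *)
Lemma hodograph (R : realType) (n : nat) (b : nat -> 'cV[R]_2) :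
  derive1 (bezier n.+1 b) = bezier n (fun j => n.+1%:R *: (b j.+1 - b j)).
Proof.
apply/funext => t; rewrite /bezier.
under eq_fun do under eq_bigr do rewrite -horner_bernstein_poly.
rewrite derive1_horner_comb big_ord_recl deriv_bernstein_poly0.
under eq_bigr do rewrite deriv_bernstein_polyS hornerZ hornerD hornerN
  !horner_bernstein_poly -scalerA scalerBl.
rewrite -scaler_sumr sumrB hornerN hornerZ horner_bernstein_poly.
under [RHS]eq_bigr do rewrite scalerA mulrC -scalerA scalerBr.
rewrite -scaler_sumr sumrB scaleNr -scalerA addrC -scalerBr; congr (_ *: _).
rewrite -addrA -opprD; congr (_ - _).
(* The term of index n + 1 has the binomial coefficient 'C(n, n + 1) = 0. *)
rewrite big_ord_recr/= /bernstein bin_small // !mul0r scale0r addr0.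
by rewrite [RHS]big_ord_recl addrC.
Qed.

Lemma eq_bezier (R : realType) (n : nat) (b b' : nat -> 'cV[R]_2) :
  (forall j, (j <= n)%N -> b j = b' j) -> bezier n b = bezier n b'.
Proof.
move=> bE; apply/funext => t; rewrite /bezier.
by apply: eq_bigr => j _; rewrite bE // -ltnS.
Qed.

(** The binomial formula for (1 - t + t s)^n, once for each ratio s. *)
Lemma bezier_geometric (R : realType) (n : nat) (s1 s2 : R) (u1 u2 : 'cV[R]_2) (t : R) :
  bezier n (fun j => s1 ^+ j *: u1 + s2 ^+ j *: u2) t
  = (1 - t + t * s1) ^+ n *: u1 + (1 - t + t * s2) ^+ n *: u2.
Proof.
have sumE s : \sum_(j < n.+1) bernstein n j t * s ^+ j = (1 - t + t * s) ^+ n.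
  rewrite exprDn; apply: eq_bigr => j _.
  by rewrite /bernstein exprMn -mulr_natl; ring.
rewrite /bezier -!sumE !scaler_suml -big_split /=.
by apply: eq_bigr => j _; rewrite scalerDr !scalerA.
Qed.

(** * Plane geometry *)

Lemma det2E (R : realType) (u v : 'cV[R]_2) :
  det2 u v = u 0 0 * v 1 0 - u 1 0 * v 0 0.
Proof.
have row0 i : row_mx u v i 0 = u i 0.
  by rewrite mxE; case: splitP => j //; rewrite ord1.
have row1 i : row_mx u v i 1 = v i 0.
  by rewrite mxE; case: splitP => j; rewrite ord1.
have l1 : lift 0 0 = 1 :> 'I_2 by apply: val_inj.
have l0 : lift 1 0 = 0 :> 'I_2 by apply: val_inj.
have l1' : lift ord0 ord0 = 1 :> 'I_2 by apply: val_inj.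
rewrite /det2 (expand_det_row _ 0) big_ord_recl big_ord1.
rewrite l1' /cofactor !det_mx11 row0 row1 /row' /col'.
rewrite mxE [X in _ + _ * (_ * X)]mxE mxE [X in _ + _ * (_ * X)]mxE l1 l0 row0 row1 /=.
ring.
Qed.

Lemma det2_comb (R : realType) (a1 a2 c1 c2 : R) (u1 u2 : 'cV[R]_2) :
  det2 (a1 *: u1 + a2 *: u2) (c1 *: u1 + c2 *: u2)
  = (a1 * c2 - a2 * c1) * det2 u1 u2.
Proof. by rewrite !det2E !mxE; ring. Qed.

Definition dot (R : realType) (u v : 'cV[R]_2) : R :=
  u 0 0 * v 0 0 + u 1 0 * v 1 0.

Lemma enormE (R : realType) (u : 'cV[R]_2) : enorm u = Num.sqrt (dot u u).
Proof.
rewrite /enorm big_ord_recl big_ord1; congr (Num.sqrt (_ + u _ 0 ^+ 2)).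
exact: val_inj.
Qed.

Lemma dot_unit (R : realType) (u : 'cV[R]_2) : enorm u = 1 -> dot u u = 1.
Proof.
rewrite enormE => u1; rewrite -[LHS]sqr_sqrtr ?u1 ?expr1n //.
by rewrite addr_ge0 // sqr_ge0.
Qed.

Lemma enorm_comb (R : realType) (a1 a2 : R) (u1 u2 : 'cV[R]_2) :
  enorm u1 = 1 -> enorm u2 = 1 ->
  enorm (a1 *: u1 + a2 *: u2) = Num.sqrt (qform (dot u1 u2) a1 a2).
Proof.
move=> /dot_unit d1 /dot_unit d2; rewrite enormE; congr Num.sqrt.
transitivity (a1 ^+ 2 * dot u1 u1 + 2 * dot u1 u2 * a1 * a2 + a2 ^+ 2 * dot u2 u2).
  by rewrite /dot !mxE; ring.
by rewrite d1 d2 !mulr1.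
Qed.

Lemma lagrange_identity (R : realType) (u v : 'cV[R]_2) :
  dot u v ^+ 2 + det2 u v ^+ 2 = dot u u * dot v v.
Proof. by rewrite det2E /dot; ring. Qed.

(** Writing the canonical basis in terms of u and v, its determinant 1 becomes a
    multiple of that of u and v. *)
Lemma det2_basis_neq0 (R : realType) (u v : 'cV[R]_2) :
  basis_of {:'cV[R]_2} [:: u; v] -> det2 u v != 0.
Proof.
move=> uvb.
have comb w : exists a c, w = a *: u + c *: v.
  have := coord_basis (X := [tuple of [:: u; v]]) uvb (memvf w).
  by rewrite big_ord_recl big_ord1 => ->; eexists; eexists.
have [a [c e]] := comb (delta_mx 0 0); have [a' [c' e']] := comb (delta_mx 1 0).
apply/eqP => uv0; have := det2_comb a c a' c' u v.
rewrite -e -e' uv0 mulr0 det2E !mxE /= => /eqP; rewrite !mulr1 !mulr0 subr0.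
by rewrite oner_eq0.
Qed.

Lemma enormZ (R : realType) (a : R) (u : 'cV[R]_2) :
  0 <= a -> enorm (a *: u) = a * enorm u.
Proof.
move=> a0; rewrite !enormE.
have -> : dot (a *: u) (a *: u) = a ^+ 2 * dot u u by rewrite /dot !mxE; ring.
by rewrite sqrtrM ?sqr_ge0 // sqrtr_sqr ger0_norm.
Qed.

(** * Generated curves *)

Lemma eigen_expr (R : realType) (M : 'M[R]_2) (s : R) (v : 'cV[R]_2) (j : nat) :
  M *m v = s *: v -> M ^+ j *m v = s ^+ j *: v.
Proof.
move=> Mv; elim: j => [|j IHj]; first by rewrite !expr0 mul1mx scale1r.
by rewrite exprSr -mulmxA Mv -scalemxAr IHj scalerA -exprS.
Qed.

Lemma derive1_generated (R : realType) (M : 'M[R]_2) (s1 s2 mu1 mu2 : R)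
    (v1 v2 : 'cV[R]_2) (n : nat) (b : nat -> 'cV[R]_2) :
  M *m v1 = s1 *: v1 -> M *m v2 = s2 *: v2 ->
  generated_by M (mu1 *: v1 + mu2 *: v2) n.+1 b ->
  derive1 (bezier n.+1 b)
  = bezier n (fun j => s1 ^+ j *: ((n.+1%:R * mu1) *: v1)
                       + s2 ^+ j *: ((n.+1%:R * mu2) *: v2)).
Proof.
move=> Mv1 Mv2 b_gen; rewrite hodograph; apply: eq_bezier => j le_jn.
rewrite b_gen // mulmxDr -!scalemxAr (eigen_expr _ Mv1) (eigen_expr _ Mv2).
by rewrite scalerDr !scalerA; congr (_ *: _ + _ *: _); ring.
Qed.

(** Using |mu1| and |mu2| as weights keeps both arguments of the form positive;
    the sign of mu1 mu2 is absorbed in the cosine, as if v2 had been reversed.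
    The weights being positive, the sign of the curvature is that of
    the constant factor. *)
Lemma curvature_generated (R : realType) (M : 'M[R]_2) (s1 s2 mu1 mu2 : R)
    (v1 v2 : 'cV[R]_2) (k : nat) (b : nat -> 'cV[R]_2) (t : R) :
  M *m v1 = s1 *: v1 -> M *m v2 = s2 *: v2 -> enorm v1 = 1 -> enorm v2 = 1 ->
  generated_by M (mu1 *: v1 + mu2 *: v2) k.+2 b ->
  curvature (bezier k.+2 b) t
  = k.+1%:R / k.+2%:R * (mu1 * mu2 * (s2 - s1) * det2 v1 v2)
    * profile (Num.sg (mu1 * mu2) * dot v1 v2) `|mu1| `|mu2| k
        (1 - t + t * s1) (1 - t + t * s2).
Proof.
move=> Mv1 Mv2 v1_unit v2_unit b_gen.
rewrite /curvature derive1nS derive1n1.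
rewrite (derive1_generated Mv1 Mv2 b_gen) hodograph.
rewrite [bezier k _](eq_bezier (b' := fun j =>
    s1 ^+ j *: ((k.+1%:R * k.+2%:R * mu1 * (s1 - 1)) *: v1)
    + s2 ^+ j *: ((k.+1%:R * k.+2%:R * mu2 * (s2 - 1)) *: v2))); last first.
  move=> j _; rewrite /= opprD addrACA -!scalerBl scalerDr !scalerA !exprS.
  by congr (_ *: _ + _ *: _); ring.
rewrite !bezier_geometric !scalerA det2_comb.
set A := 1 - t + t * s1; set B := 1 - t + t * s2.
have -> : (A ^+ k.+1 * (k.+2%:R * mu1)) *: v1 + (B ^+ k.+1 * (k.+2%:R * mu2)) *: v2
    = k.+2%:R *: ((mu1 * A ^+ k.+1) *: v1 + (mu2 * B ^+ k.+1) *: v2).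
  by rewrite scalerDr !scalerA; congr (_ *: _ + _ *: _); ring.
rewrite enormZ // enorm_comb // /profile.
have -> : qform (Num.sg (mu1 * mu2) * dot v1 v2) (`|mu1| * A ^+ k.+1) (`|mu2| * B ^+ k.+1)
    = qform (dot v1 v2) (mu1 * A ^+ k.+1) (mu2 * B ^+ k.+1).
  rewrite /qform !exprMn !real_normK ?num_real //; congr (_ + _ + _).
  transitivity (2 * (Num.sg (mu1 * mu2) * `|mu1 * mu2|) * dot v1 v2
                * A ^+ k.+1 * B ^+ k.+1); first by rewrite normrM; ring.
  by rewrite -numEsg; ring.
rewrite exprMn invfM; move: (Num.sqrt _ ^+ 3)^-1 => S.
have -> : (A ^+ k.+1 * (k.+2%:R * mu1)) * (B ^+ k * (k.+1%:R * k.+2%:R * mu2 * (s2 - 1)))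
   - (B ^+ k.+1 * (k.+2%:R * mu2)) * (A ^+ k * (k.+1%:R * k.+2%:R * mu1 * (s1 - 1)))
   = k.+1%:R * k.+2%:R ^+ 2 * (mu1 * mu2) * (s2 - s1) * (A * B) ^+ k.
  by rewrite !exprS exprMn /A /B; ring.
have n0 : k.+2%:R != 0 :> R by rewrite pnatr_eq0.
by field.
Qed.

Unset Implicit Arguments.

Theorem theorem3 (R : realType) (M : 'M[R]_2) (sigma1 sigma2 : R)
    (v1 v2 w : 'cV[R]_2) (mu1 mu2 : R)
    (sigma_ge : sigma1 >= sigma2) (sigma_gt0 : sigma2 > 0)
    (v_basis : basis_of {:'cV[R]_2} [:: v1; v2])
    (v1_eigen : M *m v1 = sigma1 *: v1) (v2_eigen : M *m v2 = sigma2 *: v2)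
    (v1_unit : enorm v1 = 1) (v2_unit : enorm v2 = 1)
    (sigma_sum : sigma1 + sigma2 - 2 >= 0)
    (w_def : w = mu1 *: v1 + mu2 *: v2) (w_neq0 : w != 0)
    (mu_ge : `|mu1| >= `|mu2|) (mu_gt0 : `|mu2| > 0)
    (n : nat) (n_ge2 : (2 <= n)%N)
    (b : nat -> 'cV[R]_2) (b_gen : generated_by M w n b) :
  let kappa := curvature (bezier n b) in
  [/\ monotonic_on01 kappa,
      kappa 0 > 0 -> decreasing_on01 kappa
    & kappa 0 < 0 -> increasing_on01 kappa].
Proof.
case: n n_ge2 b_gen => [|[|k]] // _ b_gen kappa.
rewrite w_def in b_gen.
set C := k.+1%:R / k.+2%:R * (mu1 * mu2 * (sigma2 - sigma1) * det2 v1 v2).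
set c := Num.sg (mu1 * mu2) * dot v1 v2.
pose P t := profile c `|mu1| `|mu2| k (1 - t + t * sigma1) (1 - t + t * sigma2).
have kappaE t : kappa t = C * P t.
  exact: (curvature_generated _ v1_eigen v2_eigen).
have mu1_gt0 : 0 < `|mu1| := lt_le_trans mu_gt0 mu_ge.
(* The vectors are unit, so 1 - c ^+ 2 is the square of their determinant. *)
have c_bound : -1 < c < 1.
  have det_gt0 : 0 < det2 v1 v2 ^+ 2.
    by rewrite exprn_even_gt0 //= det2_basis_neq0.
  have := lagrange_identity v1 v2.
  rewrite (dot_unit v1_unit) (dot_unit v2_unit) mulr1 => dot_det.
  have : c ^+ 2 < 1.
    rewrite exprMn sqr_sg mulf_neq0 -?normr_gt0 // mul1r; lra.
  by move=> c2; apply/andP; split; nra.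
have P_gt0 t : t \in `[0, 1] -> 0 < P t.
  rewrite in_itv /= => /andP[t0 t1].
  by apply: profile_gt0 => //; nra.
have P_lt t t' : sigma2 < sigma1 -> t \in `[0, 1] -> t' \in `[0, 1] ->
    t < t' -> P t' < P t.
  move=> s21; rewrite !in_itv /= => /andP[t0 t1] /andP[t'0 t'1] tt'.
  by apply: profile_lt => //; rewrite ?mu_gt0 //; try (apply/andP; split); nra.
have C_neq0 : C != 0 -> sigma2 < sigma1.
  move=> C0; rewrite lt_neqAle sigma_ge andbT; apply: contraNneq C0 => s_eq.
  by rewrite /C s_eq subrr mulr0 mul0r mulr0.
have decr : 0 < C -> decreasing_on01 kappa.
  move=> C0 x y xI yI xy; rewrite !kappaE ltr_pM2l // P_lt //.
  by rewrite C_neq0 // gt_eqF.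
have incr : C < 0 -> increasing_on01 kappa.
  move=> C0 x y xI yI xy; rewrite !kappaE ltr_nM2l // P_lt //.
  by rewrite C_neq0 // lt_eqF.
have P0 : 0 < P 0 by apply: P_gt0; rewrite in_itv /= lexx ler01.
split; [|by rewrite kappaE pmulr_lgt0|by rewrite kappaE pmulr_llt0].
case: (ltrgtP C 0) => [/incr|/decr|C0].
- by left; exact: ltW_homo_in.
- by right; exact: ltW_nhomo_in.
- by left=> x y _ _ _; rewrite !kappaE C0 !mul0r.
Qed.
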